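(* Let $\{\alpha_m\}_{m\in\mathbb{N}}\subset\mathbb{N}$ be a sequence that satisfies $\alpha_m\ge m$ for all $m\in\mathbb{N}$ and let $z_1\in(0,1)$ be given. Let $\{\beta_m\}_{m\in\mathbb{N}}\subset\mathbb{R}$, $\{z_k\}_{k\in\mathbb{N}}\subset\mathbb{R}$, and $\{q_k\}_{k\in\mathbb{N}}\subset\mathbb{N}$ be sequences that have been generated by Algorithm A (see context) with input data $\{\alpha_m\}_{m\in\mathbb{N}}$ and $z_1$. Define $$P(z):=\sum_{m=1}^\infty\beta_m z^{\alpha_m}\qquad\text{and}\qquad P_L(z):=\sum_{m=1}^{q_L}\beta_m z^{\alpha_m}\ \text{ for } L\in\mathbb{N}.$$ Then the following statements are true: (i) It holds $0<z_k<z_{k+1}<1$ for all $k\in\mathbb{N}$ and $z_k\to1$ for $k\to\infty$. (ii) It holds $\beta_m\in[-1,1]$ for all $m\in\mathbb{N}$ and $$\sum_{m=1}^\infty|\beta_m|^\gamma=\sum_{m=1}^\infty\left(\frac1m\right)^\gamma<\infty\qquad\forall\gamma\in(1,\infty).$$ (iii) The power series $P$ has radius of convergence one, and it holds $P(z_k)>0$ for all $k\in\mathbb{N}$ that are odd and $P(z_k)<0$ for all $k\in\mathbb{N}$ that are even. (iv) For all $L\in\mathbb{N}$, it holds $P_L(z_k)>0$ for all $k=1,\ldots,L$ that are odd and $P_L(z_k)<0$ for all $k=1,\ldots,L$ that are even.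
   Context: $\mathbb{N}=\{1,2,3,\ldots\}$. The sequence $\{\alpha_m\}$ is not assumed to be increasing. Algorithm A. Input: $z_1\in(0,1)$ and $\{\alpha_m\}_{m\in\mathbb{N}}\subset\mathbb{N}$ with $\alpha_m\ge m$ for all $m$. Initialize $p_1:=1$, $q_1:=1$, $r_1:=1$, $\beta_1:=1$. For $k=1,2,3,\ldots$ do the following steps in order: (a) Choose $p_{k+1}\in\mathbb{N}$ such that $p_{k+1}>q_k$ and $\left|\sum_{m=1}^{q_k}\beta_m z_k^{\alpha_m}\right|>\sum_{m=p_{k+1}}^\infty z_k^{\alpha_m}>0$. (b) Set $\beta_m:=0$ for all $m=q_k+1,\ldots,p_{k+1}-1$. (c) Choose $r_{k+1}\in\mathbb{N}$ such that $r_{k+1}>r_k+1$ and $\left|\sum_{m=1}^{q_k}\beta_m\right|<\sum_{m=r_k+1}^{r_{k+1}}\frac1m$. (d) Choose $z_{k+1}\in(z_k,1)$ such that $\left|\sum_{m=1}^{q_k}\beta_m z_{k+1}^{\alpha_m}\right|<\sum_{m=r_k+1}^{r_{k+1}}\frac1m z_{k+1}^{\alpha_{m+p_{k+1}-r_k-1}}$. (e) Set $q_{k+1}:=p_{k+1}+r_{k+1}-r_k-1$. (f) For $i=1,\ldots,r_{k+1}-r_k$, define $\beta_{i+p_{k+1}-1}:=\frac{1}{r_k+i}$ if $k+1$ is odd, and $\beta_{i+p_{k+1}-1}:=\frac{-1}{r_k+i}$ if $k+1$ is even. Sequences are ''generated by Algorithm A'' if they arise from the initialization and steps (a)–(f)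 of Algorithm A for some (arbitrary) admissible choices in (a), (c), (d). *)

(* Defs.v *)
From Stdlib Require Import Reals Arith.
From Coquelicot Require Import Coquelicot.

Open Scope R_scope.

(* All sequences are indexed by {1, 2, 3, ...}: they are functions on [nat]
   whose value at 0 is irrelevant.  Accordingly, an infinite sum over m >= 1 is
   [Series (fun n => u (S n))], and [sum_n_m u a b] is the sum of [u m] over
   a <= m <= b. *)

Definition term (alpha : nat -> nat) (beta : nat -> R) (x : R) (m : nat) : R :=
  beta m * x ^ alpha m.

Definition P (alpha : nat -> nat) (beta : nat -> R) (x : R) : R :=
  Series (fun n => term alpha beta x (S n)).

Definition P_trunc (alpha : nat -> nat) (beta : nat -> R) (q : nat -> nat)
    (L : nat) (x : R) : R :=
  sum_n_m (term alpha beta x) 1 (q L).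

(* The coefficient of x ^ n in P.  Since alpha need not be injective, several m
   may contribute to the same n; as alpha m >= m, only m <= n can. *)
Definition coef (alpha : nat -> nat) (beta : nat -> R) (n : nat) : R :=
  sum_n_m (fun m => if Nat.eqb (alpha m) n then beta m else 0) 1 n.

(* x ^ g for x >= 0 and g > 0.  [Rpower] alone is wrong at the base 0:
   [Rpower 0 g = 1]. *)
Definition nnpow (x g : R) : R :=
  if Req_dec_T x 0 then 0 else Rpower x g.

(* A run of Algorithm A.  The natural number subtractions never truncate, by
   [step_c_r] and the ranges of the indices. *)
Record algorithm_A_run (alpha : nat -> nat) (z1 : R)
    (p q r : nat -> nat) (beta z : nat -> R) : Prop := {
  init_z : z 1%nat = z1;
  init_p : p 1%nat = 1%nat;
  init_q : q 1%nat = 1%nat;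
  init_r : r 1%nat = 1%nat;
  init_beta : beta 1%nat = 1;
  step_a_p : forall k, (1 <= k)%nat -> (q k < p (S k))%nat;
  step_a : forall k, (1 <= k)%nat ->
    0 < Series (fun n => z k ^ alpha (p (S k) + n)%nat)
      < Rabs (sum_n_m (term alpha beta (z k)) 1 (q k));
  step_b : forall k m, (1 <= k)%nat ->
    (q k + 1 <= m <= p (S k) - 1)%nat -> beta m = 0;
  step_c_r : forall k, (1 <= k)%nat -> (r k + 1 < r (S k))%nat;
  step_c : forall k, (1 <= k)%nat ->
    Rabs (sum_n_m beta 1 (q k))
      < sum_n_m (fun m => 1 / INR m) (r k + 1) (r (S k));
  step_d_z : forall k, (1 <= k)%nat -> z k < z (S k) < 1;
  step_d : forall k, (1 <= k)%nat ->
    Rabs (sum_n_m (term alpha beta (z (S k))) 1 (q k))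
      < sum_n_m
          (fun m => 1 / INR m * z (S k) ^ alpha (m + p (S k) - r k - 1)%nat)
          (r k + 1) (r (S k));
  step_e : forall k, (1 <= k)%nat ->
    q (S k) = (p (S k) + r (S k) - r k - 1)%nat;
  step_f_odd : forall k i, (1 <= k)%nat -> Nat.Odd (S k) ->
    (1 <= i <= r (S k) - r k)%nat ->
    beta (i + p (S k) - 1)%nat = 1 / INR (r k + i);
  step_f_even : forall k i, (1 <= k)%nat -> Nat.Even (S k) ->
    (1 <= i <= r (S k) - r k)%nat ->
    beta (i + p (S k) - 1)%nat = -1 / INR (r k + i)
}.

Definition generated_by_algorithm_A (alpha : nat -> nat) (z1 : R)
    (beta z : nat -> R) (q : nat -> nat) : Prop :=
  exists p r : nat -> nat, algorithm_A_run alpha z1 p q r beta z.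

(* Main.v *)
(* The partial sum up to q k has the right sign at z k: by (d) the block added
   last dominates everything before it.  By (a) the remaining terms are too small
   to change that sign, whether they are kept up to q L or summed to infinity.

   Consecutive values P (z k), P (z (k + 1)) have opposite signs, so P has a root
   in each interval (z k, z (k + 1)), and these roots accumulate at l = lim z k.
   If l were smaller than the radius of convergence, the identity theorem would
   give P = 0 at z 1, which is impossible.  Hence the radius is at most l <= 1,
   and since |beta m| <= 1 and m <= alpha m it is at least 1: both equal 1.

   The identity theorem is obtained without derivatives.  If the coefficients of
   f are at most C rho ^ n in absolute value and f (w) = 0 with |w| <= 1, then the
   coefficients of f / (x - w) are at most C K rho ^ n with K = rho / (1 - rho).
   Dividing by N roots at distance at most d from x gives
   |f (x)| <= (d K) ^ N C / (1 - rho), hence f (x) = 0 as soon as d K < 1, and f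
   vanishes on all of [-1, 1] by continuation in steps of fixed length. *)
Require Import Defs.
From Stdlib Require Import Reals Arith.
From Coquelicot Require Import Coquelicot.
From Stdlib Require Import Ranalysis5 Lra Lia.

Open Scope R_scope.

(** * Roots of power series *)

Lemma geometric_bound_series (b : nat -> R) (rho C : R) :
  0 <= rho < 1 -> (forall n, Rabs (b n) <= C * rho ^ n) ->
  ex_series b /\ Rabs (Series b) <= C / (1 - rho).
Proof.
intros Hr Hb.
assert (Hrho : Rabs rho < 1) by (rewrite Rabs_pos_eq; lra).
assert (Hg : ex_series (fun n => C * rho ^ n)).
{ exact (@ex_series_scal R_AbsRing R_NormedModule C _ (ex_series_geom rho Hrho)). }
assert (Habs : ex_series (fun n => Rabs (b n))).
{ apply (@ex_series_le R_AbsRing R_CompleteNormedModule _ (fun n => C * rho ^ n)).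
  - intros n; change (Rabs (Rabs (b n)) <= C * rho ^ n).
    rewrite Rabs_Rabsolu; apply Hb.
  - exact Hg. }
split; [apply ex_series_Rabs; exact Habs|].
eapply Rle_trans; [apply Series_Rabs; exact Habs|].
eapply Rle_trans.
{ apply (Series_le _ (fun n => C * rho ^ n)); [|exact Hg].
  intros n; split; [apply Rabs_pos | apply Hb]. }
rewrite (Series_scal_l C (fun n => rho ^ n)), (is_series_unique _ _ (is_series_geom rho Hrho)).
apply Rle_refl.
Qed.

Lemma geometric_bound_pseries (a : nat -> R) (rho C x : R) :
  0 <= rho < 1 -> (forall n, Rabs (a n) <= C * rho ^ n) -> Rabs x <= 1 ->
  ex_pseries a x /\ Rabs (PSeries a x) <= C / (1 - rho).
Proof.
intros Hr Ha Hx.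
destruct (geometric_bound_series (fun n => a n * x ^ n) rho C) as [H1 H2].
- exact Hr.
- intros n; rewrite Rabs_mult.
  assert (Hp : Rabs (x ^ n) <= 1).
  { rewrite <- RPow_abs, <- (pow1 n); apply pow_incr.
    split; [apply Rabs_pos | exact Hx]. }
  pose proof (Rabs_pos (a n)); pose proof (Ha n); nra.
- split; [apply ex_pseries_R; exact H1 | exact H2].
Qed.

(* The coefficients of the quotient by [x - zeta] are the values at [zeta] of
   the shifted series. *)
Lemma pseries_divide_root (a : nat -> R) (rho C zeta : R) :
  0 <= rho < 1 -> (forall n, Rabs (a n) <= C * rho ^ n) -> Rabs zeta <= 1 ->
  PSeries a zeta = 0 ->
  exists g : nat -> R,
    (forall n, Rabs (g n) <= C * (rho / (1 - rho)) * rho ^ n) /\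
    (forall x, Rabs x <= 1 -> PSeries a x = (x - zeta) * PSeries g x).
Proof.
intros Hr Ha Hz Hroot.
set (shift := fun n j => a (n + j)%nat).
assert (Hshift : forall n j, Rabs (shift n j) <= (C * rho ^ n) * rho ^ j).
{ intros n j; unfold shift; rewrite Rmult_assoc, <- pow_add; apply Ha. }
set (g := fun n => PSeries (shift (S n)) zeta).
assert (Hg : forall n, Rabs (g n) <= C * (rho / (1 - rho)) * rho ^ n).
{ intros n; unfold g.
  destruct (geometric_bound_pseries (shift (S n)) rho (C * rho ^ S n) zeta Hr
    (Hshift (S n)) Hz) as [_ H].
  eapply Rle_trans; [exact H|]; right; simpl; field; lra. }
(* Horner's scheme: the first coefficient of the shifted series is split off. *)
assert (Hrec : forall n, PSeries (shift n) zeta = a n + zeta * g n).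
{ intros n; rewrite PSeries_decr_1.
  - unfold g; f_equal; [unfold shift; f_equal; lia|].
    f_equal; apply PSeries_ext; intros j; unfold PS_decr_1, shift.
    f_equal; lia.
  - exact (proj1 (geometric_bound_pseries _ _ _ _ Hr (Hshift n) Hz)). }
exists g; split; [exact Hg|].
intros x Hx.
assert (Heg : ex_pseries g x)
  by exact (proj1 (geometric_bound_pseries _ _ _ _ Hr Hg Hx)).
transitivity (PSeries (PS_minus (PS_incr_1 g) (PS_scal zeta g)) x).
- apply PSeries_ext; intros n.
  unfold PS_minus, PS_plus, PS_opp, PS_scal, PS_incr_1.
  change (a n = (match n with O => 0 | S m => g m end) + - (zeta * g n)).
  destruct n as [|n].
  (* This is where [zeta] has to be a root: the left side of [Hrec 0] is [PSeries a zeta], the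
     remainder of the division. *)
  + pose proof (Hrec 0%nat) as H0.
    change (PSeries a zeta = a 0%nat + zeta * g 0%nat) in H0; lra.
  + pose proof (Hrec (S n)) as H0.
    change (g n = a (S n) + zeta * g (S n)) in H0; lra.
- rewrite PSeries_minus, PSeries_incr_1, PSeries_scal.
  + ring.
  + apply ex_pseries_incr_1; exact Heg.
  + apply ex_pseries_scal; [apply Rmult_comm | exact Heg].
Qed.

(** Induction on [N], generalizing [a], [w] and [C]. Dividing out [w 0] costs a factor
    [rho / (1 - rho)] in the coefficient bound and yields a factor [x - w 0] of size at most [d]. By
    injectivity the other [w n] differ from [w 0], so they remain roots of the quotient. *)
Lemma pseries_bound_by_roots (N : nat) (a w : nat -> R) (rho C d x : R) :
  0 <= rho < 1 -> (forall n, Rabs (a n) <= C * rho ^ n) ->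
  (forall i j, w i = w j -> i = j) -> (forall n, Rabs (w n) <= 1) ->
  (forall n, PSeries a (w n) = 0) ->
  Rabs x <= 1 -> (forall n, Rabs (x - w n) <= d) ->
  Rabs (PSeries a x) <= (d * (rho / (1 - rho))) ^ N * (C / (1 - rho)).
Proof.
revert a w C; induction N as [|N IH]; intros a w C Hr Ha Hinj Hw H0 Hx Hd.
- simpl; rewrite Rmult_1_l.
  exact (proj2 (geometric_bound_pseries _ _ _ _ Hr Ha Hx)).
- destruct (pseries_divide_root a rho C (w 0%nat) Hr Ha (Hw 0%nat) (H0 0%nat))
    as [g [Hg Hfac]].
  rewrite Hfac by exact Hx; rewrite Rabs_mult.
  assert (HI : Rabs (PSeries g x)
    <= (d * (rho / (1 - rho))) ^ N * (C * (rho / (1 - rho)) / (1 - rho))).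
  { apply (IH g (fun n => w (S n))); try assumption.
    - intros i j Hij; apply Hinj in Hij; lia.
    - intros n; apply Hw.
    - intros n; pose proof (H0 (S n)) as Hz; rewrite Hfac in Hz by apply Hw.
      apply Rmult_integral in Hz; destruct Hz as [Hz|Hz]; [|exact Hz].
      assert (E : S n = 0%nat) by (apply Hinj; lra); discriminate E.
    - intros n; apply Hd. }
  eapply Rle_trans.
  { apply Rmult_le_compat; [apply Rabs_pos | apply Rabs_pos
      | apply (Hd 0%nat) | exact HI]. }
  right; simpl; field; lra.
Qed.

(** The preceding bound is available for every [N], and its right-hand side tends to 0 as [N]
    grows. *)
Lemma pseries_zero_near_roots (a w : nat -> R) (rho C d x : R) :
  0 <= rho < 1 -> (forall n, Rabs (a n) <= C * rho ^ n) ->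
  (forall i j, w i = w j -> i = j) -> (forall n, Rabs (w n) <= 1) ->
  (forall n, PSeries a (w n) = 0) ->
  d * (rho / (1 - rho)) < 1 ->
  Rabs x <= 1 -> (forall n, Rabs (x - w n) <= d) ->
  PSeries a x = 0.
Proof.
intros Hr Ha Hinj Hw H0 Hd1 Hx Hd.
set (t := d * (rho / (1 - rho))) in *.
assert (Ht : 0 <= t).
{ apply Rmult_le_pos.
  - eapply Rle_trans; [apply Rabs_pos | apply (Hd 0%nat)].
  - apply Rdiv_le_0_compat; lra. }
assert (Hlim : is_lim_seq (fun N => t ^ N * (C / (1 - rho))) 0).
{ replace (Finite 0) with (Rbar_mult 0 (C / (1 - rho)))
    by (simpl; f_equal; ring).
  apply is_lim_seq_scal_r; apply is_lim_seq_geom; rewrite Rabs_pos_eq; lra. }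
assert (Hle : Rabs (PSeries a x) <= 0).
{ apply (is_lim_seq_le (fun _ => Rabs (PSeries a x))
    (fun N => t ^ N * (C / (1 - rho))) (Rabs (PSeries a x)) 0).
  - intros N.
    apply (pseries_bound_by_roots N a w rho C d x Hr Ha Hinj Hw H0 Hx Hd).
  - apply is_lim_seq_const.
  - exact Hlim. }
apply Rabs_eq_0; apply Rle_antisym; [exact Hle | apply Rabs_pos].
Qed.

Lemma pseries_zero_of_roots_tend_to_1 (a w : nat -> R) (rho C : R) :
  0 <= rho < 1 -> (forall n, Rabs (a n) <= C * rho ^ n) ->
  (forall i j, w i = w j -> i = j) -> (forall n, Rabs (w n) <= 1) ->
  (forall n, PSeries a (w n) = 0) -> is_lim_seq w 1 ->
  forall x, Rabs x <= 1 -> PSeries a x = 0.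
Proof.
intros Hr Ha Hinj Hw H0 Hlim.
set (K := rho / (1 - rho)).
assert (HK : 0 <= K) by (apply Rdiv_le_0_compat; lra).
(* Both the start and the continuation use roots at distance up to [2 * d]; this choice gives
   [2 * d * K < 1 / 2]. *)
set (d := / (4 * (K + 1))).
assert (Hd : 0 < d) by (apply Rinv_0_lt_compat; lra).
assert (HdK : 2 * d * K < 1).
{ assert (E : 4 * d * (K + 1) = 1) by (unfold d; field; lra). nra. }
assert (Hstart : forall x, 1 - d <= x <= 1 -> Rabs x <= 1 -> PSeries a x = 0).
{ intros x Hx Hx1.
  assert (Hev : eventually (fun n => Rabs (w n - 1) < d)).
  { apply is_lim_seq_spec in Hlim; exact (Hlim (mkposreal d Hd)). }
  destruct Hev as [N HN].
  apply (pseries_zero_near_roots a (fun n => w (N + n)%nat) rho C (2 * d) x);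
    try assumption.
  - intros i j Hij; apply Hinj in Hij; lia.
  - intros n; apply Hw.
  - intros n; apply H0.
  - intros n; specialize (HN (N + n)%nat ltac:(lia)).
    apply Rabs_le; apply Rabs_def2 in HN; lra. }
(* Each step pushes the interval on which the series vanishes further left by [d]. *)
assert (Hstep : forall n x, 1 - (INR n + 1) * d <= x -> Rabs x <= 1 ->
  PSeries a x = 0).
{ induction n as [|n IH]; intros x Hx Hx1.
  - apply Hstart; [|exact Hx1].
    simpl in Hx; pose proof (Rabs_le_between x 1); lra.
  - destruct (Rle_lt_dec (1 - (INR n + 1) * d) x) as [Hge|Hlt];
      [apply IH; assumption|].
    rewrite S_INR in Hx.
    pose proof (proj1 (Rabs_le_between x 1) Hx1) as Hx2.
    set (c := 1 - (INR n + 1) * d) in *.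
    assert (Hc1 : c < 1) by (unfold c; pose proof (pos_INR n); nra).
    (* By induction the series vanishes on [[c, 1]]. The points [c + h / (k + 1)] serve as new
       distinct roots: [h <= d] keeps them within [2 * d] of [x], and [h <= 1 - c] keeps them at
       most 1. *)
    set (h := Rmin d (1 - c)).
    assert (Hh : 0 < h <= d /\ h <= 1 - c).
    { unfold h; pose proof (Rmin_l d (1 - c)); pose proof (Rmin_r d (1 - c)).
      split; [split; [apply Rmin_glb_lt; lra | lra] | lra]. }
    assert (Hw' : forall k, 0 < h / (INR k + 1) <= h).
    { intros k; pose proof (pos_INR k); split.
      - apply Rdiv_lt_0_compat; lra.
      - apply Rle_div_l; nra. }
    assert (Hw1 : forall k, Rabs (c + h / (INR k + 1)) <= 1).
    { intros k; pose proof (Hw' k); apply Rabs_le; lra. }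
    apply (pseries_zero_near_roots a (fun k => c + h / (INR k + 1)) rho C
      (2 * d) x); try assumption.
    + intros i j Hij; apply INR_eq.
      pose proof (pos_INR i); pose proof (pos_INR j).
      assert (E : h / (INR i + 1) = h / (INR j + 1)) by lra.
      assert (E1 : h * (INR j + 1) = h * (INR i + 1)).
      { replace (h * (INR j + 1))
          with (h / (INR i + 1) * (INR i + 1) * (INR j + 1)) by (field; lra).
        rewrite E; field; lra. }
      apply Rmult_eq_reg_l in E1; lra.
    + intros k; apply IH; [pose proof (Hw' k); lra | apply Hw1].
    + intros k; pose proof (Hw' k).
      assert (Hcd : c - d <= x) by (unfold c; lra).
      apply Rabs_le; lra. }
intros x Hx.
(* The interval [[-1, 1]] has length 2, so more than [2 / d] steps exhaust it. *)
destruct (INR_unbounded (2 / d)) as [n Hn].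
apply (Hstep n); [|exact Hx].
apply Rabs_le_between in Hx.
apply Rlt_gt in Hn; apply (Rmult_lt_compat_r d) in Hn; [|exact Hd].
replace (2 / d * d) with 2 in Hn by (field; lra); nra.
Qed.

(** Take [r] strictly between [l] and the radius. The terms [a n * r ^ n] tend to 0, hence are
    bounded, and passing from [r] to [l] gains the ratio [rho = l / r]. *)
Lemma coef_bound_inside_CV_radius (a : nat -> R) (l : R) :
  0 < l -> Rbar_lt l (CV_radius a) ->
  exists rho C, 0 <= rho < 1 /\ forall n, Rabs (a n * l ^ n) <= C * rho ^ n.
Proof.
intros Hl Hlt.
assert (Hex : exists r, l < r /\ Rbar_lt r (CV_radius a)).
{ destruct (CV_radius a) as [c| |].
  - exists ((l + c) / 2); simpl in *; lra.
  - exists (l + 1); simpl; lra.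
  - destruct Hlt. }
destruct Hex as [r [Hr1 Hr2]].
assert (Hser : ex_series (fun n => Rabs (a n * r ^ n))).
{ apply CV_disk_inside; rewrite Rabs_pos_eq by lra; exact Hr2. }
apply ex_series_lim_0 in Hser; apply is_lim_seq_spec in Hser.
destruct (Hser (mkposreal 1 Rlt_0_1)) as [N HN]; simpl in HN.
assert (Hbd : forall M, exists C, forall n, (n < M)%nat -> Rabs (a n * r ^ n) <= C).
{ induction M as [|M [C HC]]; [exists 0; intros n Hn; lia|].
  exists (Rmax C (Rabs (a M * r ^ M))); intros n Hn.
  destruct (Nat.eq_dec n M) as [->|Hne]; [apply Rmax_r|].
  eapply Rle_trans; [apply HC; lia | apply Rmax_l]. }
destruct (Hbd N) as [C HC].
assert (HC' : forall n, Rabs (a n * r ^ n) <= Rmax C 1).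
{ intros n; destruct (Nat.lt_ge_cases n N) as [Hn|Hn].
  - eapply Rle_trans; [apply HC, Hn | apply Rmax_l].
  - specialize (HN n Hn); rewrite Rminus_0_r, Rabs_Rabsolu in HN.
    eapply Rle_trans; [left; exact HN | apply Rmax_r]. }
exists (l / r), (Rmax C 1); split.
- split; [apply Rdiv_le_0_compat; lra | apply Rlt_div_l; lra].
- intros n.
  replace (a n * l ^ n) with (a n * r ^ n * (l / r) ^ n).
  + rewrite Rabs_mult, (Rabs_pos_eq ((l / r) ^ n)).
    * apply Rmult_le_compat_r; [|apply HC'].
      apply pow_le; apply Rdiv_le_0_compat; lra.
    * apply pow_le; apply Rdiv_le_0_compat; lra.
  + unfold Rdiv; rewrite Rpow_mult_distr, pow_inv.
    field; apply pow_nonzero; lra.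
Qed.

(** Rescaling the variable by [l] moves the limit of the roots to 1 and turns the coefficients into
    [a n * l ^ n], which are geometrically bounded. *)
Lemma pseries_zero_of_accumulating_roots (a w : nat -> R) (l : R) :
  0 < l -> Rbar_lt l (CV_radius a) ->
  (forall i j, w i = w j -> i = j) -> (forall n, Rabs (w n) <= l) ->
  (forall n, PSeries a (w n) = 0) -> is_lim_seq w l ->
  forall x, Rabs x <= l -> PSeries a x = 0.
Proof.
intros Hl Hcv Hinj Hw H0 Hlim x Hx.
destruct (coef_bound_inside_CV_radius a l Hl Hcv) as [rho [C [Hr Hb]]].
assert (Hscale : forall y, PSeries a y = PSeries (fun n => a n * l ^ n) (y / l)).
{ intros y; apply Series_ext; intros n.
  unfold Rdiv; rewrite Rpow_mult_distr, pow_inv.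
  field; apply pow_nonzero; lra. }
assert (Habs : forall y, Rabs y <= l -> Rabs (y / l) <= 1).
{ intros y Hy; unfold Rdiv; rewrite Rabs_mult, (Rabs_pos_eq (/ l)).
  - apply Rle_div_l; lra.
  - left; apply Rinv_0_lt_compat, Hl. }
rewrite Hscale.
apply (pseries_zero_of_roots_tend_to_1 _ (fun n => w n / l) rho C Hr Hb).
- intros i j Hij; apply Hinj.
  replace (w i) with (w i / l * l) by (field; lra).
  rewrite Hij; field; lra.
- intros n; apply Habs, Hw.
- intros n; rewrite <- Hscale; apply H0.
- replace (Finite 1) with (Rbar_mult l (/ l)) by (simpl; f_equal; field; lra).
  apply is_lim_seq_scal_r, Hlim.
- apply Habs, Hx.
Qed.

(** * Sums and series *)

Lemma sum_n_m_shift (F : nat -> R) (a b d : nat) :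
  sum_n_m F (a + d) (b + d) = sum_n_m (fun j => F (j + d)%nat) a b.
Proof.
revert F; induction d as [|d IH]; intros F.
- rewrite !Nat.add_0_r; apply sum_n_m_ext; intros j; f_equal; lia.
- rewrite <- !plus_n_Sm, <- sum_n_m_S, IH.
  apply sum_n_m_ext; intros j; f_equal; lia.
Qed.

Lemma sum_n_m_S_R (F : nat -> R) (n : nat) :
  sum_n_m F 1 (S n) = sum_n_m F 1 n + F (S n).
Proof. rewrite sum_n_Sm by lia; reflexivity. Qed.

Lemma sum_n_m_Rabs_le (F : nat -> R) (c : R) (N : nat) :
  (forall m, (1 <= m <= N)%nat -> Rabs (F m) <= c) ->
  Rabs (sum_n_m F 1 N) <= INR N * c.
Proof.
induction N as [|N IH]; intros HF.
- rewrite sum_n_m_zero by lia.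
  change (Rabs 0 <= 0 * c); rewrite Rabs_R0, Rmult_0_l; lra.
- rewrite sum_n_m_S_R, S_INR.
  pose proof (Rabs_triang (sum_n_m F 1 N) (F (S N))).
  assert (Rabs (sum_n_m F 1 N) <= INR N * c) by (apply IH; intros m Hm; apply HF; lia).
  pose proof (HF (S N) ltac:(lia)); lra.
Qed.

Lemma sum_n_m_Rmult_l (F : nat -> R) (c : R) (a b : nat) :
  sum_n_m (fun j => c * F j) a b = c * sum_n_m F a b.
Proof. exact (sum_n_m_mult_l (K := R_Ring) c F a b). Qed.

Lemma is_lim_seq_sum_of_is_series (u : nat -> R) (s : R) :
  is_series (fun n => u (S n)) s <-> is_lim_seq (fun n => sum_n_m u 1 n) s.
Proof.
rewrite is_lim_seq_incr_1.
change (is_series (fun n => u (S n)) s) with (is_lim_seq (sum_n (fun n => u (S n))) s).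
split; intros H; (eapply is_lim_seq_ext; [|exact H]); intros n;
  unfold sum_n; rewrite sum_n_m_S; reflexivity.
Qed.

(** With [t] midway between [y] and 1 and [/ t = 1 + h], Bernoulli's inequality bounds [n * t ^ n]
    by [/ h]. Since [y <= t ^ 2], one factor [t ^ n] is left over to force the limit 0. *)
Lemma is_lim_seq_nat_mul_geom (y : R) :
  0 <= y < 1 -> is_lim_seq (fun n => INR n * y ^ S n) 0.
Proof.
intros Hy.
set (t := (1 + y) / 2).
assert (Ht : 0 < t < 1) by (unfold t; lra).
set (h := / t - 1).
assert (Hh : 0 < h).
{ pose proof (Rinv_lt_contravar t 1 ltac:(lra) ltac:(lra)) as H.
  rewrite Rinv_1 in H; unfold h; lra. }
apply (is_lim_seq_le_le (fun _ => 0) _ (fun n => t ^ n * / h)).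
- intros n.
  pose proof (pos_INR n) as Hn.
  pose proof (pow_le y n (proj1 Hy)) as Hyn.
  split; [simpl; apply Rmult_le_pos; nra|].
  assert (H1 : INR n * h * t ^ n <= 1).
  { pose proof (poly n h Hh) as Hb.
    replace (1 + h) with (/ t) in Hb by (unfold h; ring).
    rewrite pow_inv in Hb.
    assert (Hp : 0 < t ^ n) by (apply pow_lt; lra).
    apply (Rmult_le_compat_r (t ^ n)) in Hb; [|lra].
    rewrite Rinv_l in Hb by lra; lra. }
  (* AM-GM: [y <= t ^ 2] *)
  assert (H2 : y ^ n <= t ^ n * t ^ n).
  { rewrite <- Rpow_mult_distr; apply pow_incr; unfold t; nra. }
  assert (Hp : 0 < t ^ n) by (apply pow_lt; lra).
  assert (H3 : INR n * t ^ n <= / h).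
  { apply (Rmult_le_reg_l h); [exact Hh|]; rewrite Rinv_r by lra; lra. }
  simpl; apply Rle_trans with (INR n * y ^ n); [pose proof (Rmult_le_pos _ _ Hn Hyn); nra|].
  apply Rle_trans with (INR n * (t ^ n * t ^ n)).
  + apply Rmult_le_compat_l; assumption.
  + nra.
- apply is_lim_seq_const.
- replace (Finite 0) with (Rbar_mult 0 (/ h)) by (simpl; f_equal; ring).
  apply is_lim_seq_scal_r, is_lim_seq_geom; rewrite Rabs_pos_eq; lra.
Qed.

Lemma is_lim_seq_sum_nonneg_bounded (u : nat -> R) (M : R) :
  (forall m, 0 <= u m) -> (forall n, sum_n_m u 1 n <= M) ->
  exists s : R, is_lim_seq (fun n => sum_n_m u 1 n) s.
Proof.
intros Hu HM.
destruct (ex_finite_lim_seq_incr (fun n => sum_n_m u 1 n) M) as [s Hs].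
- intros n; rewrite sum_n_m_S_R; pose proof (Hu (S n)); lra.
- exact HM.
- exists s; exact Hs.
Qed.

(** * Convergence of the sum of the powers of [1 / m] *)

Lemma nnpow_nonneg (x g : R) : 0 <= nnpow x g.
Proof.
unfold nnpow; destruct (Req_dec_T x 0); [lra|].
left; apply exp_pos.
Qed.

(** A telescoping form of the integral test. With [x = INR n], the inequality
    [ln x <= ln (x + 1) - / (x + 1)] is inserted into [Rpower x (- e)], and [1 + t <= exp t] is
    applied at [t = e / (x + 1)]. *)
Lemma nnpow_inv_telescope (e : R) (n : nat) :
  0 < e -> (1 <= n)%nat ->
  e * nnpow (1 / INR (S n)) (e + 1)
    <= Rpower (INR n) (- e) - Rpower (INR (S n)) (- e).
Proof.
intros He Hn.
assert (Hn1 : 1 <= INR n) by (apply (le_INR 1); lia).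
rewrite S_INR.
set (x := INR n) in *.
unfold nnpow; destruct (Req_dec_T (1 / (x + 1)) 0) as [E|_].
{ assert (0 < 1 / (x + 1)) by (apply Rdiv_lt_0_compat; lra); lra. }
assert (E1 : Rpower (1 / (x + 1)) (e + 1) = Rpower (x + 1) (- e) * / (x + 1)).
{ unfold Rpower; unfold Rdiv; rewrite Rmult_1_l, ln_Rinv by lra.
  replace ((e + 1) * - ln (x + 1)) with (- e * ln (x + 1) + - ln (x + 1)) by ring.
  rewrite exp_plus, exp_Ropp, exp_ln by lra; reflexivity. }
rewrite E1.
assert (Hln : ln x <= ln (x + 1) - / (x + 1)).
{ assert (Hx : x = (x + 1) * (1 + - / (x + 1))) by (field; lra).
  assert (Hpos : 0 < 1 + - / (x + 1)).
  { replace (1 + - / (x + 1)) with (x / (x + 1)) by (field; lra).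
    apply Rdiv_lt_0_compat; lra. }
  rewrite Hx at 1; rewrite ln_mult by lra.
  assert (ln (1 + - / (x + 1)) <= - / (x + 1)).
  { rewrite <- (ln_exp (- / (x + 1))) at 2.
    apply ln_le; [exact Hpos | apply exp_ineq1_le]. }
  lra. }
assert (Hpow : Rpower (x + 1) (- e) * (1 + e * / (x + 1)) <= Rpower x (- e)).
{ unfold Rpower.
  apply Rle_trans with (exp (- e * ln (x + 1)) * exp (e * / (x + 1))).
  - apply Rmult_le_compat_l; [left; apply exp_pos | apply exp_ineq1_le].
  - rewrite <- exp_plus.
    assert (Hmono : forall a b, a <= b -> exp a <= exp b).
    { intros a b [Hab| ->]; [left; apply exp_increasing, Hab | apply Rle_refl]. }
    apply Hmono; nra. }
lra.
Qed.

Lemma ex_series_riemann (g : R) :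
  1 < g -> exists s : R, is_lim_seq (fun n => sum_n_m (fun m => nnpow (1 / INR m) g) 1 n) s.
Proof.
intros Hg.
set (u := fun m => nnpow (1 / INR m) g).
assert (Hu1 : u 1%nat = 1).
{ unfold u, nnpow; simpl; destruct (Req_dec_T (1 / 1) 0); [lra|].
  unfold Rpower, Rdiv; rewrite Rinv_1, Rmult_1_l, ln_1, Rmult_0_r; apply exp_0. }
(* The summand at 1 accounts for [g - 1]; the remaining ones telescope, starting from the value 1 of
   the power at [INR 1]. *)
assert (Hbd : forall n,
  (g - 1) * sum_n_m u 1 (S n) <= (g - 1) + 1 - Rpower (INR (S n)) (- (g - 1))).
{ induction n as [|n IH].
  - rewrite sum_n_n, Hu1; simpl; unfold Rpower; rewrite ln_1, Rmult_0_r, exp_0; lra.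
  - rewrite sum_n_m_S_R.
    pose proof (nnpow_inv_telescope (g - 1) (S n) ltac:(lra) ltac:(lia)) as H.
    replace (g - 1 + 1) with g in H by ring.
    change (nnpow (1 / INR (S (S n))) g) with (u (S (S n))) in H; lra. }
apply (is_lim_seq_sum_nonneg_bounded u (g / (g - 1))).
- intros m; apply nnpow_nonneg.
- intros [|n].
  + rewrite sum_n_m_zero by lia; change (0 <= g / (g - 1)).
    apply Rdiv_le_0_compat; lra.
  + apply Rle_div_r; [lra|].
    pose proof (Hbd n).
    assert (0 < Rpower (INR (S n)) (- (g - 1))) by apply exp_pos; lra.
Qed.

(** * Collecting equal powers of the variable *)

Lemma term_Rabs_le (alpha : nat -> nat) (beta : nat -> R) (x : R) (m n : nat) :
  Rabs (beta m) <= 1 -> (n <= alpha m)%nat -> Rabs x <= 1 ->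
  Rabs (term alpha beta x m) <= Rabs x ^ n.
Proof.
intros Hb Ha Hx; unfold term; rewrite Rabs_mult, <- RPow_abs.
replace (alpha m) with (n + (alpha m - n))%nat by lia; rewrite pow_add.
pose proof (Rabs_pos x) as H0; pose proof (Rabs_pos (beta m)).
pose proof (pow_le _ n H0) as H1.
pose proof (pow_le _ (alpha m - n) H0) as H2.
assert (H3 : Rabs x ^ (alpha m - n) <= 1).
{ rewrite <- (pow1 (alpha m - n)); apply pow_incr; lra. }
assert (Rabs x ^ n * Rabs x ^ (alpha m - n) <= Rabs x ^ n) by nra.
assert (0 <= Rabs x ^ n * Rabs x ^ (alpha m - n)) by nra.
nra.
Qed.

(** Since [m <= alpha m], every term of degree at most [N] has index at most [N]. In the induction,
    the new index [S N] has degree above [N], and [coef] at [S N] collects precisely the indices of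
    degree [S N]. *)
Lemma coef_partial_sum (alpha : nat -> nat) (beta : nat -> R) (x : R) (N : nat) :
  (forall m, (1 <= m)%nat -> (m <= alpha m)%nat) ->
  sum_n (fun n => coef alpha beta n * x ^ n) N
    = sum_n_m (fun m => if Nat.leb (alpha m) N then term alpha beta x m else 0) 1 N.
Proof.
intros Ha; induction N as [|N IH].
- rewrite sum_O, sum_n_m_zero by lia; unfold coef; rewrite sum_n_m_zero by lia.
  change (0 * x ^ 0 = 0); ring.
- rewrite sum_Sn, IH; unfold coef.
  transitivity (sum_n_m (fun m => plus
     (if Nat.leb (alpha m) N then term alpha beta x m else 0)
     ((if Nat.eqb (alpha m) (S N) then beta m else 0) * x ^ S N)) 1 (S N)).
  + rewrite sum_n_m_plus; f_equal.
    * rewrite sum_n_m_S_R.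
      destruct (Nat.leb_spec (alpha (S N)) N) as [H|H].
      -- pose proof (Ha (S N) ltac:(lia)); lia.
      -- rewrite Rplus_0_r; reflexivity.
    * symmetry; apply (sum_n_m_mult_r (K := R_Ring)).
  + apply sum_n_m_ext; intros m; change plus with Rplus; unfold term.
    destruct (Nat.leb_spec (alpha m) N), (Nat.leb_spec (alpha m) (S N)),
      (Nat.eqb_spec (alpha m) (S N)) as [E|E]; try (exfalso; lia).
    * rewrite Rmult_0_l, Rplus_0_r; reflexivity.
    * rewrite E, Rplus_0_l; reflexivity.
    * rewrite Rmult_0_l, Rplus_0_r; reflexivity.
Qed.

(** The partial sums by index and by degree differ only in the terms with [m <= N < alpha m]. There
    are at most [N] of them, each at most [Rabs x ^ S N], so the difference tends to 0 and both
    series have the same sum. *)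
Lemma is_series_term_coef (alpha : nat -> nat) (beta : nat -> R) (x : R) :
  (forall m, (1 <= m)%nat -> (m <= alpha m)%nat) ->
  (forall m, (1 <= m)%nat -> Rabs (beta m) <= 1) -> Rabs x < 1 ->
  ex_pseries (coef alpha beta) x /\
  is_series (fun n => term alpha beta x (S n)) (PSeries (coef alpha beta) x).
Proof.
intros Ha Hb Hx.
assert (Hex : ex_series (fun n => term alpha beta x (S n))).
{ apply (@ex_series_le R_AbsRing R_CompleteNormedModule _ (fun n => Rabs x ^ n)).
  - intros n; apply term_Rabs_le; [apply Hb; lia | | lra].
    pose proof (Ha (S n) ltac:(lia)); lia.
  - apply ex_series_geom; rewrite Rabs_Rabsolu; exact Hx. }
destruct Hex as [s Hs].
assert (Hlim := proj1 (is_lim_seq_sum_of_is_series (term alpha beta x) s) Hs).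
assert (Hps : is_pseries (coef alpha beta) x s).
{ apply is_pseries_R.
  change (is_lim_seq (sum_n (fun n => coef alpha beta n * x ^ n)) s).
  apply (is_lim_seq_ext (fun N => sum_n_m (term alpha beta x) 1 N -
    (sum_n_m (term alpha beta x) 1 N
       - sum_n (fun n => coef alpha beta n * x ^ n) N))); [intros N; ring|].
  replace (Finite s) with (Finite (s - 0)) by (f_equal; ring).
  apply is_lim_seq_minus'; [exact Hlim|].
  apply is_lim_seq_abs_0.
  apply (is_lim_seq_le_le (fun _ => 0) _ (fun N => INR N * Rabs x ^ S N)).
  - intros N; split; [apply Rabs_pos|].
    rewrite coef_partial_sum by exact Ha.
    replace (sum_n_m (term alpha beta x) 1 N -
      sum_n_m (fun m => if Nat.leb (alpha m) N then term alpha beta x m else 0) 1 N)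
      with (sum_n_m (fun m => if Nat.leb (alpha m) N then 0 else term alpha beta x m) 1 N).
    + apply sum_n_m_Rabs_le; intros m Hm.
      destruct (Nat.leb_spec (alpha m) N).
      * rewrite Rabs_R0; apply pow_le, Rabs_pos.
      * apply term_Rabs_le; [apply Hb; lia | lia | lra].
    + assert (H : forall F G K : nat -> R, (forall m, F m + G m = K m) ->
        sum_n_m F 1 N = sum_n_m K 1 N - sum_n_m G 1 N).
      { intros F G K HK.
        rewrite <- (sum_n_m_ext _ _ 1 N HK).
        rewrite (sum_n_m_plus (G := R_AbelianMonoid) F G).
        assert (Ecancel : forall s t : R, s = s + t - t) by (intros; ring).
        apply Ecancel. }
      apply H; intros m; destruct (Nat.leb (alpha m) N);
        [apply Rplus_0_l | apply Rplus_0_r].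
  - apply is_lim_seq_const.
  - apply is_lim_seq_nat_mul_geom; split; [apply Rabs_pos | exact Hx]. }
split; [exists s; exact Hps|].
rewrite (is_pseries_unique _ _ _ Hps); exact Hs.
Qed.

(** This factor lets odd and even [k] share one argument: it is the sign of the entries of block
    [k], and the sign claims become positivity after multiplication by it. *)
Definition block_sign (k : nat) : R := if Nat.even k then -1 else 1.

Lemma block_sign_cases (k : nat) : block_sign k = 1 \/ block_sign k = -1.
Proof. unfold block_sign; destruct (Nat.even k); auto. Qed.

Lemma block_sign_odd (k : nat) : Nat.Odd k -> block_sign k = 1.
Proof.
intros Hk; apply Nat.odd_spec in Hk; unfold block_sign.
rewrite <- Nat.negb_odd, Hk; reflexivity.
Qed.

Lemma block_sign_even (k : nat) : Nat.Even k -> block_sign k = -1.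
Proof. intros Hk; apply Nat.even_spec in Hk; unfold block_sign; rewrite Hk; reflexivity. Qed.

Lemma block_sign_S (k : nat) : block_sign (S k) = - block_sign k.
Proof.
unfold block_sign; rewrite Nat.even_succ, <- Nat.negb_even.
destruct (Nat.even k); simpl; ring.
Qed.

Lemma Rabs_block_sign_mul (k : nat) (x : R) : Rabs (block_sign k * x) = Rabs x.
Proof.
rewrite Rabs_mult; destruct (block_sign_cases k) as [-> | ->].
- rewrite Rabs_R1; ring.
- rewrite Rabs_left by lra; ring.
Qed.

(** * Runs of Algorithm A *)

Section Run.

Context (alpha : nat -> nat) (z1 : R) (p q r : nat -> nat) (beta z : nat -> R).
Context (halpha : forall m, (1 <= m)%nat -> (m <= alpha m)%nat) (hz1 : 0 < z1 < 1).
Context (run : algorithm_A_run alpha z1 p q r beta z).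

Lemma run_z_bounds (k : nat) : (1 <= k)%nat -> 0 < z k < 1.
Proof.
induction 1 as [|k Hk IH].
- rewrite (init_z _ _ _ _ _ _ _ run); exact hz1.
- pose proof (step_d_z _ _ _ _ _ _ _ run k Hk); lra.
Qed.

(** Together with [q k < p (S k)] this keeps the subtraction in [run_offset] from truncating. *)
Lemma run_r_le_q (k : nat) : (1 <= k)%nat -> (1 <= r k <= q k)%nat.
Proof.
induction 1 as [|k Hk IH].
- rewrite (init_r _ _ _ _ _ _ _ run), (init_q _ _ _ _ _ _ _ run); lia.
- pose proof (step_a_p _ _ _ _ _ _ _ run k Hk).
  pose proof (step_c_r _ _ _ _ _ _ _ run k Hk).
  pose proof (step_e _ _ _ _ _ _ _ run k Hk); lia.
Qed.

(* [m = j + run_offset k] places the entry [1 / j] of block [k + 1]. *)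
Definition run_offset (k : nat) : nat := (p (S k) - r k - 1)%nat.

Lemma run_offset_eqs (k : nat) : (1 <= k)%nat ->
  p (S k) = (r k + 1 + run_offset k)%nat /\
  q (S k) = (r (S k) + run_offset k)%nat /\ (q k < p (S k) <= q (S k))%nat.
Proof.
intros Hk; unfold run_offset.
pose proof (run_r_le_q k Hk).
pose proof (step_a_p _ _ _ _ _ _ _ run k Hk).
pose proof (step_c_r _ _ _ _ _ _ _ run k Hk).
pose proof (step_e _ _ _ _ _ _ _ run k Hk); lia.
Qed.

Lemma run_r_lt_S (k : nat) : (1 <= k)%nat -> (r k < r (S k))%nat.
Proof. intros Hk; pose proof (step_c_r _ _ _ _ _ _ _ run k Hk); lia. Qed.

Lemma run_q_lt_S (k : nat) : (1 <= k)%nat -> (q k < q (S k))%nat.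
Proof. intros Hk; pose proof (run_offset_eqs k Hk); lia. Qed.

Lemma run_le_q (k : nat) : (1 <= k)%nat -> (k <= q k)%nat.
Proof.
induction 1 as [|k Hk IH].
- rewrite (init_q _ _ _ _ _ _ _ run); lia.
- pose proof (run_q_lt_S k Hk); lia.
Qed.

Lemma run_q_mono (k l : nat) : (1 <= k <= l)%nat -> (q k <= q l)%nat.
Proof.
intros [Hk Hl]; induction Hl as [|l Hl IH]; [lia|].
pose proof (run_q_lt_S l ltac:(lia)); lia.
Qed.

Lemma run_beta_block (k j : nat) : (1 <= k)%nat -> (r k + 1 <= j <= r (S k))%nat ->
  beta (j + run_offset k)%nat = block_sign (S k) / INR j.
Proof.
intros Hk Hj.
pose proof (run_offset_eqs k Hk) as Hoff.
replace (j + run_offset k)%nat with ((j - r k) + p (S k) - 1)%nat by lia.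
destruct (Nat.Even_or_Odd (S k)) as [He|Ho].
- rewrite (step_f_even _ _ _ _ _ _ _ run k (j - r k)) by (assumption || lia).
  rewrite block_sign_even by exact He; do 2 f_equal; lia.
- rewrite (step_f_odd _ _ _ _ _ _ _ run k (j - r k)) by (assumption || lia).
  rewrite block_sign_odd by exact Ho; do 2 f_equal; lia.
Qed.

Lemma run_beta_zero (k m : nat) : (1 <= k)%nat -> (q k < m < p (S k))%nat ->
  beta m = 0.
Proof.
intros Hk Hm; apply (step_b _ _ _ _ _ _ _ run k m Hk); lia.
Qed.

Lemma run_beta_le_1 (m : nat) : (1 <= m)%nat -> Rabs (beta m) <= 1.
Proof.
intros Hm.
assert (H : forall k, (1 <= k)%nat -> forall m, (1 <= m <= q k)%nat ->
  Rabs (beta m) <= 1).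
{ clear m Hm; induction 1 as [|k Hk IH]; intros m Hm.
  - rewrite (init_q _ _ _ _ _ _ _ run) in Hm.
    replace m with 1%nat by lia.
    rewrite (init_beta _ _ _ _ _ _ _ run), Rabs_R1; lra.
  - pose proof (run_offset_eqs k Hk) as Hoff.
    destruct (Nat.le_gt_cases m (q k)) as [H1|H1]; [apply IH; lia|].
    destruct (Nat.lt_ge_cases m (p (S k))) as [H2|H2].
    + rewrite (run_beta_zero k m) by lia; rewrite Rabs_R0; lra.
    + replace m with ((m - run_offset k) + run_offset k)%nat by lia.
      rewrite run_beta_block by lia.
      unfold Rdiv; rewrite Rabs_block_sign_mul.
      assert (Hj : 1 <= INR (m - run_offset k)).
      { apply (le_INR 1); lia. }
      rewrite Rabs_pos_eq.
      * rewrite <- Rinv_1; apply Rinv_le_contravar; lra.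
      * left; apply Rinv_0_lt_compat; lra. }
apply (H m Hm); pose proof (run_le_q m Hm); lia.
Qed.

(** The summand is abstracted to [F] so that the same decomposition into blocks serves the terms of
    the power series and the powers of the coefficients. *)
Lemma run_sum_gap (F : R -> nat -> R) (k n : nat) :
  (forall m, F 0 m = 0) -> (1 <= k)%nat -> (q k <= n < p (S k))%nat ->
  sum_n_m (fun m => F (beta m) m) 1 n = sum_n_m (fun m => F (beta m) m) 1 (q k).
Proof.
intros HF Hk [Hn1 Hn2]; induction Hn1 as [|n Hn IH]; [reflexivity|].
rewrite sum_n_m_S_R, IH by lia.
rewrite (run_beta_zero k (S n)) by lia; rewrite HF; apply Rplus_0_r.
Qed.

Lemma run_sum_block (F : R -> nat -> R) (k : nat) :
  (forall m, F 0 m = 0) -> (1 <= k)%nat ->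
  sum_n_m (fun m => F (beta m) m) 1 (q (S k))
    = sum_n_m (fun m => F (beta m) m) 1 (q k)
      + sum_n_m (fun j => F (block_sign (S k) / INR j) (j + run_offset k)%nat)
          (r k + 1) (r (S k)).
Proof.
intros HF Hk.
pose proof (run_offset_eqs k Hk) as Hoff.
rewrite (sum_n_m_Chasles _ 1 (p (S k) - 1) (q (S k))) by lia.
rewrite run_sum_gap with (k := k) by (assumption || lia).
change plus with Rplus; f_equal.
replace (S (p (S k) - 1)) with (r k + 1 + run_offset k)%nat by lia.
replace (q (S k)) with (r (S k) + run_offset k)%nat by lia.
rewrite (sum_n_m_shift (fun m => F (beta m) m)).
apply sum_n_m_ext_loc; intros j Hj; rewrite run_beta_block by assumption.
reflexivity.
Qed.

(** * Signs of the partial sums and of the power series at [z k] *)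

Lemma run_sign_at_q (k : nat) : (1 <= k)%nat ->
  0 < block_sign k * sum_n_m (term alpha beta (z k)) 1 (q k).
Proof.
intros Hk; destruct k as [|[|k]]; [lia| |].
- rewrite (init_q _ _ _ _ _ _ _ run), sum_n_n; unfold term.
  rewrite (init_beta _ _ _ _ _ _ _ run); unfold block_sign; simpl.
  rewrite !Rmult_1_l; apply pow_lt; apply run_z_bounds; lia.
- clear Hk; assert (Hk : (1 <= S k)%nat) by lia.
  set (l := S k) in *; clearbody l.
  pose proof (step_d _ _ _ _ _ _ _ run l Hk) as Hd.
  pose proof (run_offset_eqs l Hk) as Hoff.
  rewrite (run_sum_block (fun b m => b * z (S l) ^ alpha m)) by
    (assumption || (intros; apply Rmult_0_l)).
  (* [A] is the sum over the earlier indices and [T] the absolute value of the last block, both at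
     [z (S l)]; (d) says [Rabs A < T]. *)
  match type of Hd with Rabs ?a < ?b => set (A := a) in Hd; set (T := b) in Hd end.
  match goal with |- 0 < _ * (?a + ?b) => replace b with (block_sign (S l) * T) end.
  + change (0 < block_sign (S l) * (A + block_sign (S l) * T)).
    rewrite <- (Rabs_block_sign_mul (S l) A) in Hd.
    apply Rabs_def2 in Hd.
    assert (block_sign (S l) * block_sign (S l) = 1).
    { destruct (block_sign_cases (S l)) as [-> | ->]; ring. }
    replace (block_sign (S l) * (A + block_sign (S l) * T)) with
      (block_sign (S l) * A + block_sign (S l) * block_sign (S l) * T) by ring.
    rewrite H; lra.
  + unfold T; rewrite <- sum_n_m_Rmult_l; apply sum_n_m_ext_loc; intros j Hj.
    replace (j + p (S l) - r l - 1)%nat with (j + run_offset l)%nat by lia.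
    match goal with |- ?x = ?y => change (x = y :> R) end; unfold Rdiv; ring.
Qed.

(** The coefficients vanish between [q k] and [p (S k)] and are at most 1 in absolute value
    afterwards. A bound uniform in [n] covers the truncations and, in the limit, the full series. *)
Lemma run_tail (k n : nat) : (1 <= k)%nat -> (q k <= n)%nat ->
  Rabs (sum_n_m (term alpha beta (z k)) 1 n
    - sum_n_m (term alpha beta (z k)) 1 (q k))
  <= Series (fun i => z k ^ alpha (p (S k) + i)%nat).
Proof.
intros Hk Hn.
pose proof (run_z_bounds k Hk) as Hz.
pose proof (run_offset_eqs k Hk) as Hoff.
pose proof (step_a _ _ _ _ _ _ _ run k Hk) as [HT _].
set (u := fun i => z k ^ alpha (p (S k) + i)%nat) in *.
assert (Hgap : forall n, (q k <= n < p (S k))%nat ->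
  sum_n_m (term alpha beta (z k)) 1 n = sum_n_m (term alpha beta (z k)) 1 (q k)).
{ intros i Hi; apply (run_sum_gap (fun b m => b * z k ^ alpha m)); try assumption.
  intros; apply Rmult_0_l. }
assert (Hterm : forall i,
  Rabs (term alpha beta (z k) (p (S k) + i)) <= u i).
{ intros i; unfold u; rewrite <- (Rabs_pos_eq (z k)) at 2 by lra.
  apply term_Rabs_le; [apply run_beta_le_1; lia | lia | rewrite Rabs_pos_eq; lra]. }
destruct (Nat.lt_ge_cases n (p (S k))) as [Hlt|Hge].
{ rewrite Hgap by lia; rewrite Rminus_diag, Rabs_R0; lra. }
replace n with (p (S k) + (n - p (S k)))%nat by lia.
generalize (n - p (S k))%nat as i; clear n Hn Hge.
assert (Hpart : forall i, Rabs (sum_n_m (term alpha beta (z k)) 1 (p (S k) + i)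
    - sum_n_m (term alpha beta (z k)) 1 (q k)) <= sum_n u i).
{ induction i as [|i IH].
  - rewrite sum_O.
    replace (p (S k) + 0)%nat with (S (p (S k) - 1)) by lia.
    rewrite sum_n_m_S_R, Hgap by lia.
    pose proof (Hterm 0%nat) as H0.
    replace (p (S k) + 0)%nat with (S (p (S k) - 1)) in H0 by lia.
    match goal with |- Rabs ?x <= _ => replace x with
      (term alpha beta (z k) (S (p (S k) - 1))) by ring end.
    exact H0.
  - rewrite sum_Sn; change plus with Rplus.
    pose proof (Hterm (S i)) as H0.
    rewrite <- plus_n_Sm in *; rewrite sum_n_m_S_R.
    match goal with |- Rabs (?a + ?b - ?c) <= _ =>
      replace (a + b - c) with ((a - c) + b) by ring;
      pose proof (Rabs_triang (a - c) b) end.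
    lra. }
intros i; eapply Rle_trans; [apply Hpart|].
apply (is_lim_seq_incr_compare (sum_n u)).
- assert (Hex : ex_series u).
  { apply (@ex_series_le R_AbsRing R_CompleteNormedModule _ (fun n => z k ^ n)).
    - intros j; change (Rabs (u j) <= z k ^ j).
      assert (Hj : (j <= alpha (p (S k) + j))%nat).
      { pose proof (halpha (p (S k) + j) ltac:(lia)); lia. }
      unfold u; rewrite Rabs_pos_eq by (apply pow_le; lra).
      replace (alpha (p (S k) + j)%nat) with (j + (alpha (p (S k) + j) - j))%nat by lia.
      rewrite pow_add.
      assert (0 <= z k ^ j) by (apply pow_le; lra).
      assert (z k ^ (alpha (p (S k) + j) - j) <= 1).
      { rewrite <- (pow1 (alpha (p (S k) + j) - j)); apply pow_incr; lra. }
      nra.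
    - apply ex_series_geom; rewrite Rabs_pos_eq; lra. }
  exact (Series_correct u Hex).
- intros j; rewrite sum_Sn; change plus with Rplus.
  assert (0 <= u (S j)) by (apply pow_le; lra); lra.
Qed.

(** The slack in (a) serves as [delta]. It does not depend on [n], so strict positivity survives the
    passage to the infinite sum. *)
Lemma run_sign (k : nat) : (1 <= k)%nat ->
  exists delta, 0 < delta /\ forall n, (q k <= n)%nat ->
    delta <= block_sign k * sum_n_m (term alpha beta (z k)) 1 n.
Proof.
intros Hk.
pose proof (run_sign_at_q k Hk) as Hs.
pose proof (step_a _ _ _ _ _ _ _ run k Hk) as [_ HT].
set (Sq := sum_n_m (term alpha beta (z k)) 1 (q k)) in *.
exists (Rabs Sq - Series (fun i => z k ^ alpha (p (S k) + i)%nat)).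
split; [lra|]; intros n Hn.
pose proof (run_tail k n Hk Hn) as Ht; fold Sq in Ht.
rewrite <- (Rabs_block_sign_mul k) in Ht.
rewrite <- (Rabs_block_sign_mul k Sq), Rabs_pos_eq by lra.
apply Rabs_le_between in Ht; lra.
Qed.

Lemma run_sign_P_trunc (L k : nat) : (1 <= k <= L)%nat ->
  0 < block_sign k * P_trunc alpha beta q L (z k).
Proof.
intros Hk; destruct (run_sign k) as [d [Hd H]]; [lia|].
eapply Rlt_le_trans; [exact Hd|]; apply H, run_q_mono, Hk.
Qed.

Lemma run_series_coef (x : R) : Rabs x < 1 ->
  ex_pseries (coef alpha beta) x /\
  is_series (fun n => term alpha beta x (S n)) (PSeries (coef alpha beta) x).
Proof. apply is_series_term_coef; [exact halpha | exact run_beta_le_1]. Qed.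

Lemma run_sign_PSeries (k : nat) : (1 <= k)%nat ->
  0 < block_sign k * PSeries (coef alpha beta) (z k).
Proof.
intros Hk; destruct (run_sign k Hk) as [d [Hd H]].
pose proof (run_z_bounds k Hk) as Hz.
assert (Hx : Rabs (z k) < 1) by (rewrite Rabs_pos_eq; lra).
destruct (run_series_coef (z k) Hx) as [_ Hs].
apply is_lim_seq_sum_of_is_series in Hs.
eapply Rlt_le_trans; [exact Hd|].
apply (is_lim_seq_le_loc (fun _ => d)
  (fun n => block_sign k * sum_n_m (term alpha beta (z k)) 1 n) d
  (block_sign k * PSeries (coef alpha beta) (z k))).
- exists (q k); exact H.
- apply is_lim_seq_const.
- exact (is_lim_seq_scal_l _ (block_sign k) _ Hs).
Qed.

(** * Radius of convergence and limit of the points [z k] *)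

Lemma run_CV_radius_ge_1 : Rbar_le 1 (CV_radius (coef alpha beta)).
Proof.
apply Rbar_not_lt_le; intros Hlt.
assert (Hx : exists x, 0 <= x < 1 /\ Rbar_lt (CV_radius (coef alpha beta)) x).
{ pose proof (CV_radius_ge_0 (coef alpha beta)) as H0.
  destruct (CV_radius (coef alpha beta)) as [c| |]; simpl in *; try contradiction.
  exists ((c + 1) / 2); lra. }
destruct Hx as [x [Hx Hc]].
assert (Hax : Rabs x = x) by (apply Rabs_pos_eq; lra).
apply (CV_disk_outside (coef alpha beta) x); [rewrite Hax; exact Hc|].
apply ex_series_lim_0, ex_pseries_R, run_series_coef; lra.
Qed.

(** The root is given in a sig type, so that a sequence of roots can be defined by projection,
    without a choice principle. *)
Lemma run_root (k : nat) : (1 <= k)%nat ->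
  {w : R | z k < w < z (S k) /\ PSeries (coef alpha beta) w = 0}.
Proof.
intros Hk; set (f := PSeries (coef alpha beta)).
pose proof (run_z_bounds k Hk) as Hz.
pose proof (step_d_z _ _ _ _ _ _ _ run k Hk) as Hz'.
pose proof (run_sign_PSeries k Hk) as H1.
pose proof (run_sign_PSeries (S k) ltac:(lia)) as H2.
rewrite block_sign_S in H2; fold f in H1, H2.
(* The factor [- block_sign k] makes the function negative at [z k] and positive at [z (S k)], as
   [IVT_interv] demands. *)
destruct (IVT_interv (fun x => - block_sign k * f x) (z k) (z (S k))) as [w [Hw Hw0]].
- intros a Ha; apply continuity_pt_mult.
  + apply continuity_pt_const; intros x y; reflexivity.
  + apply PSeries_continuity.
    eapply Rbar_lt_le_trans; [|exact run_CV_radius_ge_1].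
    simpl; rewrite Rabs_pos_eq; lra.
- lra.
- lra.
- lra.
- exists w.
  assert (Hf : f w = 0).
  { apply Rmult_integral in Hw0; destruct Hw0 as [H|H]; [|exact H].
    exfalso; destruct (block_sign_cases k); lra. }
  assert (w <> z k) by (intros ->; rewrite Hf in H1; lra).
  assert (w <> z (S k)) by (intros ->; rewrite Hf in H2; lra).
  split; [lra | exact Hf].
Qed.

Lemma run_z_lt (k l : nat) : (1 <= k < l)%nat -> z k < z l.
Proof.
intros [Hk Hl]; induction Hl as [|l Hl IH].
- exact (proj1 (step_d_z _ _ _ _ _ _ _ run k Hk)).
- pose proof (step_d_z _ _ _ _ _ _ _ run l ltac:(lia)); lra.
Qed.

(* Otherwise the roots between consecutive [z k] would accumulate inside the
   disc of convergence. *)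
Lemma run_CV_radius_le_lim (l : R) :
  is_lim_seq z l -> Rbar_le (CV_radius (coef alpha beta)) l.
Proof.
intros Hl; apply Rbar_not_lt_le; intros Hlt.
assert (Hz : forall n, z (S n) < l).
{ intros n.
  apply Rlt_le_trans with (z (S (S n))); [apply run_z_lt; lia|].
  apply (is_lim_seq_incr_compare (fun n => z (S n)) l) with (n := S n).
  - apply is_lim_seq_incr_1 in Hl; exact Hl.
  - intros j; left; apply run_z_lt; lia. }
set (w := fun n => proj1_sig (run_root (S n) ltac:(lia))).
assert (Hw : forall n, z (S n) < w n < z (S (S n)) /\
    PSeries (coef alpha beta) (w n) = 0).
{ intros n; unfold w; destruct run_root as [x Hx]; exact Hx. }
assert (Hpos := run_z_bounds 1 ltac:(lia)).
assert (Hwlt : forall i j, (i < j)%nat -> w i < w j).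
{ intros i j Hij; destruct (Hw i) as [Hi _], (Hw j) as [Hj _].
  destruct (Nat.eq_dec j (S i)) as [-> |Hne]; [lra|].
  pose proof (run_z_lt (S (S i)) (S j) ltac:(lia)); lra. }
assert (H0 : PSeries (coef alpha beta) (z 1%nat) = 0).
{ apply (pseries_zero_of_accumulating_roots _ w l); try assumption.
  - pose proof (Hz 0%nat); lra.
  - intros i j Hij; destruct (Nat.lt_total i j) as [H|[H|H]]; [|exact H|];
      apply Hwlt in H; lra.
  - intros n; destruct (Hw n) as [Hn _].
    pose proof (run_z_bounds (S n) ltac:(lia)); pose proof (Hz (S n)).
    rewrite Rabs_pos_eq; lra.
  - intros n; apply Hw.
  - apply (is_lim_seq_le_le (fun n => z (S n)) _ (fun n => z (S (S n)))).
    + intros n; destruct (Hw n); lra.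
    + apply is_lim_seq_incr_1 in Hl; exact Hl.
    + apply is_lim_seq_incr_1 in Hl.
      apply (is_lim_seq_incr_1 (fun n => z (S n))) in Hl; exact Hl.
  - pose proof (Hz 0%nat); rewrite Rabs_pos_eq; lra. }
pose proof (run_sign_PSeries 1 ltac:(lia)) as H1; rewrite H0 in H1; lra.
Qed.

Lemma run_lim_z : is_lim_seq z 1.
Proof.
(* The shift skips the arbitrary value [z 0]. The limit is then pinned down by
   [1 <= CV_radius <= l <= 1]. *)
destruct (ex_finite_lim_seq_incr (fun n => z (S n)) 1) as [l Hl].
- intros n; left; apply run_z_lt; lia.
- intros n; left; apply run_z_bounds; lia.
- apply is_lim_seq_incr_1 in Hl.
  pose proof (run_CV_radius_le_lim l Hl) as H.
  pose proof (Rbar_le_trans _ _ _ run_CV_radius_ge_1 H) as H1; simpl in H1.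
  assert (H2 : l <= 1).
  { apply is_lim_seq_incr_1 in Hl.
    apply (is_lim_seq_le (fun n => z (S n)) (fun _ => 1) l 1);
      [|exact Hl | apply is_lim_seq_const].
    intros n; left; apply run_z_bounds; lia. }
  replace 1 with l by lra; exact Hl.
Qed.

Lemma run_CV_radius : CV_radius (coef alpha beta) = Finite 1.
Proof.
apply Rbar_le_antisym.
- exact (run_CV_radius_le_lim 1 run_lim_z).
- exact run_CV_radius_ge_1.
Qed.

(** * Power sums of the coefficients, and divergence beyond 1 *)

Lemma run_sum_nnpow (g : R) (k : nat) : (1 <= k)%nat ->
  sum_n_m (fun m => nnpow (Rabs (beta m)) g) 1 (q k)
    = sum_n_m (fun m => nnpow (1 / INR m) g) 1 (r k).
Proof.
induction 1 as [|k Hk IH].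
- rewrite (init_q _ _ _ _ _ _ _ run), (init_r _ _ _ _ _ _ _ run), !sum_n_n.
  rewrite (init_beta _ _ _ _ _ _ _ run); f_equal; simpl.
  rewrite Rabs_R1; field.
- rewrite (run_sum_block (fun b _ => nnpow (Rabs b) g)).
  + pose proof (run_r_le_q k Hk); pose proof (run_r_lt_S k Hk).
    (* Block [S k] resumes at [1 / (r k + 1)], where the previous one stopped, so no reciprocal is
       skipped or repeated. *)
    rewrite IH, (sum_n_m_Chasles _ 1 (r k) (r (S k))) by lia.
    change plus with Rplus; f_equal; rewrite Nat.add_1_r.
    apply sum_n_m_ext_loc; intros j Hj; f_equal.
    assert (0 < INR j) by (apply lt_0_INR; lia).
    unfold Rdiv; rewrite Rabs_block_sign_mul, Rmult_1_l.
    apply Rabs_pos_eq; left; apply Rinv_0_lt_compat; assumption.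
  (* The zero coefficients in the gaps contribute nothing because [nnpow 0 g = 0]. *)
  + intros _; rewrite Rabs_R0; unfold nnpow.
    destruct (Req_dec_T 0 0); [reflexivity | lra].
  + exact Hk.
Qed.

(** The partial sums up to [q k] on one side equal those up to [r k] on the other. Monotonicity and
    boundedness make the first series converge, and these two subsequences identify the limits. *)
Lemma run_sum_power (g : R) : 1 < g ->
  exists s : R,
    is_series (fun n => nnpow (Rabs (beta (S n))) g) s /\
    is_series (fun n => nnpow (1 / INR (S n)) g) s.
Proof.
intros Hg.
destruct (ex_series_riemann g Hg) as [s Hs].
assert (Hle : forall n, sum_n_m (fun m => nnpow (1 / INR m) g) 1 n <= s).
{ apply (is_lim_seq_incr_compare _ s Hs).
  intros n; rewrite sum_n_m_S_R.
  pose proof (nnpow_nonneg (1 / INR (S n)) g); lra. }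
set (u := fun m => nnpow (Rabs (beta m)) g).
assert (Hincr : forall n, sum_n_m u 1 n <= sum_n_m u 1 (S n)).
{ intros n; rewrite sum_n_m_S_R.
  pose proof (nnpow_nonneg (Rabs (beta (S n))) g); unfold u at 3; lra. }
assert (Hmono : forall m n, (m <= n)%nat -> sum_n_m u 1 m <= sum_n_m u 1 n).
{ induction 1 as [|n Hn IH]; [lra|]; pose proof (Hincr n); lra. }
destruct (is_lim_seq_sum_nonneg_bounded u s) as [s' Hs'].
- intros m; apply nnpow_nonneg.
- intros n.
  apply Rle_trans with (sum_n_m u 1 (q (S n))).
  + apply Hmono; pose proof (run_le_q (S n) ltac:(lia)); lia.
  + unfold u; rewrite run_sum_nnpow by lia; apply Hle.
- assert (E : s' = s).
  { assert (H1 : is_lim_seq (fun k => sum_n_m u 1 (q (S k))) s').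
    { apply (is_lim_seq_subseq _ _ (fun k => q (S k))); [|exact Hs'].
      apply eventually_subseq; intros n; apply run_q_lt_S; lia. }
    assert (H2 : is_lim_seq (fun k => sum_n_m u 1 (q (S k))) s).
    { apply (is_lim_seq_ext
        (fun k => sum_n_m (fun m => nnpow (1 / INR m) g) 1 (r (S k)))).
      - intros k; symmetry; apply run_sum_nnpow; lia.
      - apply (is_lim_seq_subseq _ _ (fun k => r (S k)) ) with (2 := Hs).
        apply eventually_subseq; intros n; apply run_r_lt_S; lia. }
    apply is_lim_seq_unique in H1; apply is_lim_seq_unique in H2.
    rewrite H1 in H2; injection H2; auto. }
  exists s; split; apply (is_lim_seq_sum_of_is_series (fun m => _)).
  + rewrite <- E; exact Hs'.
  + exact Hs.
Qed.

(* At [m = q k] the coefficient has absolute value [1 / r k >= 1 / m], while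
   [|x| ^ alpha m] is at least [m (|x| - 1)]. *)
Lemma run_series_diverges (x : R) : 1 < Rabs x ->
  ~ ex_series (fun n => term alpha beta x (S n)).
Proof.
intros Hx Hex.
set (h := Rabs x - 1); assert (Hh : 0 < h) by (unfold h; lra).
assert (Hlow : forall k, (1 <= k)%nat ->
  h <= Rabs (term alpha beta x (q (S k)))).
{ intros k Hk.
  pose proof (run_offset_eqs k Hk) as [_ [Hq _]].
  pose proof (run_r_le_q (S k) ltac:(lia)) as Hr.
  pose proof (run_r_lt_S k Hk).
  pose proof (halpha (q (S k)) ltac:(lia)) as Ha.
  unfold term; rewrite Rabs_mult, <- RPow_abs.
  rewrite Hq at 1; rewrite run_beta_block by lia.
  unfold Rdiv; rewrite Rabs_block_sign_mul.
  assert (Hrpos : 0 < INR (r (S k))) by (apply lt_0_INR; lia).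
  rewrite Rabs_pos_eq by (left; apply Rinv_0_lt_compat; exact Hrpos).
  apply Rmult_le_reg_l with (INR (r (S k))); [exact Hrpos|].
  rewrite <- Rmult_assoc, Rinv_r, Rmult_1_l by lra.
  pose proof (poly (alpha (q (S k))) h Hh) as Hb.
  replace (1 + h) with (Rabs x) in Hb by (unfold h; ring).
  assert (INR (r (S k)) <= INR (alpha (q (S k)))) by (apply le_INR; lia).
  nra. }
apply ex_series_lim_0 in Hex.
apply (is_lim_seq_incr_1 (term alpha beta x)) in Hex.
(* The double successor is due to [Hlow], which concerns [q (S k)] with [k >= 1]: block 1 has no
   preceding offset. *)
assert (Hsub : is_lim_seq (fun k => term alpha beta x (q (S (S k)))) 0).
{ apply (is_lim_seq_subseq _ _ (fun k => q (S (S k)))); [|exact Hex].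
  apply eventually_subseq; intros n; apply run_q_lt_S; lia. }
apply is_lim_seq_spec in Hsub.
destruct (Hsub (mkposreal h Hh)) as [N HN]; specialize (HN N (le_n N)).
simpl in HN; rewrite Rminus_0_r in HN.
pose proof (Hlow (S N) ltac:(lia)); lra.
Qed.

End Run.

Theorem theorem3p3 (alpha : nat -> nat) (z1 : R) (beta z : nat -> R)
    (q : nat -> nat)
    (halpha : forall m, (1 <= m)%nat -> (m <= alpha m)%nat)
    (hz1 : 0 < z1 < 1)
    (hgen : generated_by_algorithm_A alpha z1 beta z q) :
  (* (i) *)
  ((forall k, (1 <= k)%nat -> 0 < z k /\ z k < z (S k) /\ z (S k) < 1) /\
   is_lim_seq z 1)
  /\
  (* (ii) *)
  ((forall m, (1 <= m)%nat -> -1 <= beta m <= 1) /\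
   (forall g : R, 1 < g ->
      exists s : R,
        is_series (fun n => nnpow (Rabs (beta (S n))) g) s /\
        is_series (fun n => nnpow (1 / INR (S n)) g) s))
  /\
  (* (iii): radius of convergence one, both for P with equal powers of the
     variable collected and for the series as written; the two agree on the
     open unit interval. *)
  (CV_radius (coef alpha beta) = Finite 1 /\
   (forall x : R, Rabs x < 1 ->
      is_series (fun n => term alpha beta x (S n))
        (PSeries (coef alpha beta) x)) /\
   (forall x : R, 1 < Rabs x ->
      ~ ex_series (fun n => term alpha beta x (S n))) /\
   (forall k, (1 <= k)%nat -> Nat.Odd k -> P alpha beta (z k) > 0) /\
   (forall k, (1 <= k)%nat -> Nat.Even k -> P alpha beta (z k) < 0))
  /\
  (* (iv) *)
  (forall L, (1 <= L)%nat ->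
     (forall k, (1 <= k <= L)%nat -> Nat.Odd k ->
        P_trunc alpha beta q L (z k) > 0) /\
     (forall k, (1 <= k <= L)%nat -> Nat.Even k ->
        P_trunc alpha beta q L (z k) < 0)).
Proof.
destruct hgen as [p [r run]].
(* [P] sums the series as written, while the sign lemma concerns the collected coefficients; at
   [z k] the two sums agree. *)
assert (HP : forall k, (1 <= k)%nat ->
  P alpha beta (z k) = PSeries (coef alpha beta) (z k)).
{ intros k Hk; apply is_series_unique.
  eapply run_series_coef; [exact halpha | exact run |].
  pose proof (run_z_bounds _ _ _ _ _ _ _ hz1 run k Hk).
  rewrite Rabs_pos_eq; lra. }
split; [|split; [|split]].
- split.
  + intros k Hk.
    pose proof (run_z_bounds _ _ _ _ _ _ _ hz1 run k Hk).
    pose proof (step_d_z _ _ _ _ _ _ _ run k Hk); lra.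
  + eapply run_lim_z; eassumption.
- split.
  + intros m Hm; apply Rabs_le_between.
    eapply run_beta_le_1; eassumption.
  + eapply run_sum_power; eassumption.
- split; [eapply run_CV_radius; eassumption|].
  split; [intros x Hx; eapply run_series_coef; eassumption|].
  split; [eapply run_series_diverges; eassumption|].
  split; intros k Hk Hpar; rewrite HP by exact Hk;
    pose proof (run_sign_PSeries _ _ _ _ _ _ _ halpha hz1 run k Hk) as Hs.
  + rewrite block_sign_odd in Hs by exact Hpar; lra.
  + rewrite block_sign_even in Hs by exact Hpar; lra.
- intros L _; split; intros k Hk Hpar;
    pose proof (run_sign_P_trunc _ _ _ _ _ _ _ halpha hz1 run L k Hk) as Hs.
  + rewrite block_sign_odd in Hs by exact Hpar; lra.
  + rewrite block_sign_even in Hs by exact Hpar; lra.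
Qed.
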